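(* Let $m\ge 1$, let $\beta>0$, let $M\in\mathbb{R}^{m\times m}$ be symmetric positive definite (in particular nonsingular), let $K\in\mathbb{R}^{m\times m}$ be nonsingular, and let $$\mathcal{A}=\begin{pmatrix}2\beta M&0&-M\\0&M&K^T\\-M&K&0\end{pmatrix},\qquad \mathcal{P}=\begin{pmatrix}0&K&0\\0&M&K^T\\-M&K&0\end{pmatrix}\in\mathbb{R}^{3m\times 3m}.$$ Then the matrix $\mathcal{P}^{-1}\mathcal{A}$ has the eigenvalue $1$ with algebraic multiplicity $2m$ (that is, of the $3m$ eigenvalues of $\mathcal{P}^{-1}\mathcal{A}$ counted with algebraic multiplicity, $2m$ are equal to $1$, the remaining $m$ being described below), and the corresponding eigenvectors are of the form $$\mathbf{w}=\begin{pmatrix}\frac{1}{2\beta}(z+M^{-1}Ky)\\ y\\ z\end{pmatrix}$$ for any $y,z\in\mathbb{C}^m$ with at least one of them being nonzero. The remaining eigenvalues are of the form $$\lambda=2\beta+\frac{z^*Mz}{z^*KM^{-1}K^Tz},$$ and the corresponding eigenvectors are of the form $$v=\begin{pmatrix}-M^{-1}KM^{-1}K^Tz\\ -M^{-1}K^Tz\\ z\end{pmatrix},$$ where $z\in\mathbb{C}^m$ is an eigenvector of $2\beta I+K^{-T}MK^{-1}M$ associated with $\lambda$, i.e. $z\ne0$ and $(2\beta I+K^{-T}MK^{-1}M)z=\lambda z$.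
   Context: $z^*$ denotes the conjugate transpose of $z$, $K^{-T}=(K^T)^{-1}$, and $I$ is the $m\times m$ identity matrix. $\mathcal{P}$ is invertible whenever $M$ and $K$ are nonsingular. In the application, $M$ and $K$ are the mass and stiffness matrices of a finite element discretization, $\beta>0$ is a regularization parameter, $\mathcal{A}$ is the saddle-point matrix and $\mathcal{P}$ is the proposed preconditioner.
   Formalization: That all eigenvectors for a remaining eigenvalue λ are of the form v is stated only for λ ≠ 1; if a remaining λ equals 1, its eigenvectors are all the vectors w, and the vectors v are only some of them. *)

(* Defs.v *)
From HB Require Import structures.
From mathcomp Require Import all_boot all_order all_algebra.
From mathcomp Require Import all_reals.
From mathcomp Require Import complex.

Set Implicit Arguments.
Unset Strict Implicit.
Unset Printing Implicit Defensive.

Import Order.TTheory GRing.Theory Num.Theory.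

Local Open Scope ring_scope.
Local Open Scope complex_scope.
Local Open Scope sesquilinear_scope.

(* MathComp's [eigenvalue]/[eigenspace] are about row vectors acting on the
   left; the eigenvectors here are column vectors. *)
Definition is_eigenvector (F : fieldType) (n : nat) (A : 'M[F]_n) (a : F)
    (v : 'cV[F]_n) : Prop :=
  v != 0 /\ A *m v = a *: v.

(* [s] lists the eigenvalues of [A] with algebraic multiplicity. *)
Definition eigenvalues_are (F : fieldType) (n : nat) (A : 'M[F]_n)
    (s : seq F) : Prop :=
  char_poly A = \prod_(a <- s) ('X - a%:P).

Definition sym_posdef (R : realType) (n : nat) (M : 'M[R]_n) : Prop :=
  M^T = M /\ forall x : 'cV[R]_n, x != 0 -> 0 < (x^T *m M *m x) 0 0.

Definition row3 (T : Type) (p m : nat) (A B C : 'M[T]_(p, m)) :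
    'M[T]_(p, m + (m + m)) :=
  row_mx A (row_mx B C).

Definition col3 (T : Type) (p m : nat) (A B C : 'M[T]_(m, p)) :
    'M[T]_(m + (m + m), p) :=
  col_mx A (col_mx B C).

Definition saddle_mx (R : realType) (m : nat) (beta : R) (M K : 'M[R]_m) :
    'M[R]_(m + (m + m)) :=
  col3 (row3 ((2 * beta) *: M)  0  (- M))
       (row3 0                  M  (K^T))
       (row3 (- M)              K  0).

Definition precond_mx (R : realType) (m : nat) (M K : 'M[R]_m) :
    'M[R]_(m + (m + m)) :=
  col3 (row3 0      K  0)
       (row3 0      M  (K^T))
       (row3 (- M)  K  0).

Definition reduced_mx (R : realType) (m : nat) (beta : R) (M K : 'M[R]_m) :
    'M[R]_m :=
  (2 * beta)%:M + invmx K^T *m M *m invmx K *m M.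

Definition mxC (R : realType) (p q : nat) (A : 'M[R]_(p, q)) : 'M[R[i]]_(p, q) :=
  map_mx (real_complex R) A.

Definition qform (R : realType) (n : nat) (A : 'M[R]_n) (z : 'cV[R[i]]_n) :
    R[i] :=
  (z ^t* *m mxC A *m z) 0 0.

Definition unit_eigvec (R : realType) (m : nat) (beta : R) (M K : 'M[R]_m)
    (y z : 'cV[R[i]]_m) : 'cV[R[i]]_(m + (m + m)) :=
  col3 ((2 * beta%:C)^-1 *: (z + mxC (invmx M *m K) *m y)) y z.

Definition other_eigvec (R : realType) (m : nat) (M K : 'M[R]_m)
    (z : 'cV[R[i]]_m) : 'cV[R[i]]_(m + (m + m)) :=
  col3 (- (mxC (invmx M *m K *m invmx M *m K^T) *m z))
       (- (mxC (invmx M *m K^T) *m z))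
       z.

(* Main.v *)
Require Import Defs.
From HB Require Import structures.
From mathcomp Require Import all_boot all_order all_algebra.
From mathcomp Require Import all_reals.
From mathcomp Require Import complex.

Import Order.TTheory GRing.Theory Num.Theory.

Local Open Scope ring_scope.
Local Open Scope complex_scope.

(** Write A for the saddle-point matrix and P for the preconditioner. The two
    differ only in their first block row, so P^-1 A fixes every vector on which
    these block rows agree, i.e. every solution of
      2 beta M x - M z = K y.
    Since 2 beta M is invertible, x is a function of y and z there: the fixed
    vectors form a space of dimension 2m, parametrised as in [unit_eigvec]
    ([precond_saddle_fixedP]). The first block column (1, 0, 0) spans a
    complement of it, on which P^-1 A acts, modulo the fixed space, as
    B = 2 beta + K^-T M K^-1 M. In the basis adapted to this splitting P^-1 A is
    thus block triangular with diagonal blocks B and 1, whence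
      char_poly (P^-1 A) = (X - 1)^(2m) char_poly B
    ([char_poly_precond_saddle]), and the m remaining eigenvalues are the roots
    of char_poly B.

    For the eigenvectors, A v = lam P v with lam != 1 forces the second and
    third block rows, shared by A and P, to vanish on v = (x, y, z):
    M y + K^T z = 0 and M x = K y. This gives v the shape of [other_eigvec],
    and the first block row turns into
      M z = (lam - 2 beta) K M^-1 K^T z,
    which is the eigenvalue equation of B ([reduced_eigenP]). Multiplying it by
    z^* on the left gives the Rayleigh quotient formula for lam, the
    denominator being nonzero because K M^-1 K^T is positive definite and stays
    so on complex vectors ([sym_posdef_congr], [qform_gt0]). *)

(** * Characteristic polynomials and column eigenvectors *)

(** Similarity phrased without an inverse, so that an invariant splitting can be
    used directly as a change of basis. *)
Lemma char_poly_intertwine (F : fieldType) (n : nat) (A S T : 'M[F]_n) :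
  S \in unitmx -> A *m S = S *m T -> char_poly A = char_poly T.
Proof.
move=> S_unit AS; pose SX := map_mx (@polyC F) S.
have SX_det : \det SX != 0.
  by rewrite det_map_mx polyC_eq0 -unitfE -unitmxE.
apply: (mulIf SX_det); rewrite [RHS]mulrC -!det_mulmx; congr (\det _).
by rewrite mulmxBl mulmxBr scalar_mxC -!map_mxM AS.
Qed.

Lemma char_poly_lblock (R : comNzRingType) (m n : nat)
    (A : 'M[R]_m) (D : 'M[R]_(n, m)) (B : 'M[R]_n) :
  char_poly (block_mx A 0 D B) = char_poly A * char_poly B.
Proof.
rewrite /char_poly /char_poly_mx scalar_mx_block map_block_mx map_mx0.
by rewrite opp_block_mx add_block_mx oppr0 addr0 det_lblock.
Qed.

Lemma char_poly1 (R : comNzRingType) (n : nat) :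
  char_poly (1%:M : 'M[R]_n) = ('X - 1%:P) ^+ n.
Proof. by rewrite /char_poly /char_poly_mx map_scalar_mx -raddfB det_scalar. Qed.

(** The library characterises roots of the characteristic polynomial by row
    eigenvectors; transposition, which preserves [char_poly], gives columns. *)
Lemma root_char_polyP (F : fieldType) (n : nat) (A : 'M[F]_n) (a : F) :
  reflect (exists v, is_eigenvector A a v) (root (char_poly A) a).
Proof.
have tr_char : char_poly A = char_poly A^T.
  by rewrite /char_poly -det_tr /char_poly_mx linearB /= tr_scalar_mx map_trmx.
rewrite tr_char -eigenvalue_root_char.
apply: (iffP eigenvalueP) => [[v Av v0]|[v [v0 Av]]]; exists v^T.
- by split; [rewrite trmx_eq0 | rewrite -[A]trmxK -trmx_mul Av linearZ].
- by rewrite -trmx_mul Av linearZ.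
- by rewrite trmx_eq0.
Qed.

(** * Complexification and positive definite matrices *)

Lemma mxC_mul (R : realType) (m n p : nat) (A : 'M[R]_(m, n)) (B : 'M[R]_(n, p)) :
  mxC (A *m B) = mxC A *m mxC B.
Proof. exact: map_mxM. Qed.

Lemma mxC_tr (R : realType) (m n : nat) (A : 'M[R]_(m, n)) :
  mxC A^T = (mxC A)^T.
Proof. by rewrite /mxC map_trmx. Qed.

Lemma mxC_inv (R : realType) (n : nat) (A : 'M[R]_n) :
  mxC (invmx A) = invmx (mxC A).
Proof. exact: map_invmx. Qed.

Lemma mxC_unit (R : realType) (n : nat) (A : 'M[R]_n) :
  (mxC A \in unitmx) = (A \in unitmx).
Proof. exact: map_unitmx. Qed.

Lemma sym_posdef_unitmx (R : realType) (n : nat) (M : 'M[R]_n) :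
  sym_posdef M -> M \in unitmx.
Proof.
case=> _ Mpos; rewrite unitmxE unitfE; apply/negP=> /det0P[v v0 vM].
have := Mpos v^T; rewrite trmx_eq0 => /(_ v0).
by rewrite trmxK vM mul0mx mxE ltxx.
Qed.

(** The form of L M^-1 L^T at x is the form of M at u = M^-1 L^T x, and u is
    nonzero when x is. *)
Lemma sym_posdef_congr (R : realType) (n : nat) (M L : 'M[R]_n) :
  sym_posdef M -> L \in unitmx -> sym_posdef (L *m invmx M *m L^T).
Proof.
move=> Mspd L_unit; have M_unit := sym_posdef_unitmx _ _ _ Mspd.
have [Msym Mpos] := Mspd; split=> [|x x0].
  by rewrite !trmx_mul trmxK trmx_inv Msym mulmxA.
pose u := invmx M *m (L^T *m x).
have u0 : u != 0.
  apply: contra x0 => /eqP /(congr1 (fun w => invmx L^T *m (M *m w))).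
  by rewrite mulKVmx // mulKmx ?unitmx_tr // !mulmx0 => ->.
have := Mpos u u0; rewrite /u !trmx_mul trmxK trmx_inv Msym !mulmxA.
by rewrite mulmxKV.
Qed.

(** Writing z = x + i y with x and y real, the cross terms are
    i (x^T N y - y^T N x), which vanish because N is symmetric. *)
Lemma qform_ReIm (R : realType) (n : nat) (N : 'M[R]_n) (z : 'cV[R[i]]_n) :
  N^T = N ->
  let x := map_mx (@complex.Re R) z in let y := map_mx (@complex.Im R) z in
  qform N z = ((x^T *m N *m x) 0 0 + (y^T *m N *m y) 0 0)%:C.
Proof.
move=> Nsym x y.
have zE : z = mxC x + 'i%C *: mxC y.
  apply/matrixP=> i j; rewrite !mxE; exact: complexE.
have zcE : map_mx Num.conj z^T = mxC x^T - 'i%C *: mxC y^T.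
  apply/matrixP=> i j; rewrite !mxE; case: (z j i) => a b.
  by simpc.
have cross : x^T *m N *m y = y^T *m N *m x.
  have <- : (y^T *m N *m x)^T = x^T *m N *m y.
    by rewrite !trmx_mul trmxK Nsym mulmxA.
  by apply/matrixP=> i j; rewrite mxE !ord1.
rewrite /qform zcE [in X in _ *m X]zE mulmxBl mulmxBl !mulmxDr.
rewrite -!scalemxAl -!scalemxAr.
rewrite -!mxC_mul cross addrKA scalerA -expr2 sqr_i scaleN1r opprK.
by rewrite !mxE rmorphD.
Qed.

Lemma qform_gt0 (R : realType) (n : nat) (N : 'M[R]_n) (z : 'cV[R[i]]_n) :
  sym_posdef N -> z != 0 -> 0 < qform N z.
Proof.
move=> [Nsym Npos] z0; rewrite (qform_ReIm _ _ _ _ Nsym) ltcR.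
set x := map_mx _ z; set y := map_mx _ z.
have form_ge0 (u : 'cV[R]_n) : 0 <= (u^T *m N *m u) 0 0.
  by have [->|/Npos/ltW//] := eqVneq u 0; rewrite mulmx0 mxE.
have [x0|x0] := eqVneq x 0; last by rewrite ltr_wpDr ?Npos.
rewrite ltr_wpDl ?Npos //; apply: contra z0 => /eqP y0.
apply/eqP/matrixP=> i j; apply/eqP; rewrite mxE eq_complex /=.
move/matrixP/(_ i j): x0; move/matrixP/(_ i j): y0.
by rewrite !mxE => -> ->; rewrite eqxx.
Qed.

(** * The block equations

    The statements below allow any number p of columns: p = 1 is the case of
    vectors, while p = m + m treats a basis of the fixed space at once. *)

Lemma mulmx_saddle (R : realType) (m p : nat) (beta : R) (M K : 'M[R]_m)
    (x y z : 'M[R[i]]_(m, p)) :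
  mxC (saddle_mx beta M K) *m col3 x y z =
  col3 ((2 * beta%:C) *: (mxC M *m x) - mxC M *m z)
       (mxC M *m y + (mxC K)^T *m z)
       (mxC K *m y - mxC M *m x).
Proof.
rewrite /mxC /saddle_mx /col3 /row3 !(map_col_mx, map_row_mx).
rewrite !map_mx0 !map_mxN map_mxZ -map_trmx !mul_col_mx !mul_row_col.
rewrite !mul0mx !(add0r, addr0) !mulNmx -scalemxAl rmorphM /= rmorphD rmorph1.
by rewrite [- _ + _]addrC.
Qed.

Lemma mulmx_precond (R : realType) (m p : nat) (M K : 'M[R]_m)
    (x y z : 'M[R[i]]_(m, p)) :
  mxC (precond_mx M K) *m col3 x y z =
  col3 (mxC K *m y)
       (mxC M *m y + (mxC K)^T *m z)
       (mxC K *m y - mxC M *m x).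
Proof.
rewrite /mxC /precond_mx /col3 /row3 !(map_col_mx, map_row_mx).
rewrite !map_mx0 !map_mxN -map_trmx !mul_col_mx !mul_row_col.
by rewrite !mul0mx !(add0r, addr0) !mulNmx [- _ + _]addrC.
Qed.

Lemma col3_inj (T : Type) (p m : nat) (a b c a' b' c' : 'M[T]_(m, p)) :
  col3 a b c = col3 a' b' c' <-> [/\ a = a', b = b' & c = c'].
Proof. by split=> [/eq_col_mx[-> /eq_col_mx[-> ->]]|[-> -> ->]]. Qed.

Lemma col3_split (T : Type) (p m : nat) (w : 'M[T]_(m + (m + m), p)) :
  exists x y z, w = col3 x y z.
Proof.
by exists (usubmx w), (usubmx (dsubmx w)), (dsubmx (dsubmx w));
  rewrite /col3 !vsubmxK.
Qed.

Lemma scale_col3 (F : fieldType) (p m : nat) (a : F) (x y z : 'M[F]_(m, p)) :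
  a *: col3 x y z = col3 (a *: x) (a *: y) (a *: z).
Proof. by rewrite /col3 !scale_col_mx. Qed.

(** P (x, y, z) = 0 is solved by substitution: the first block row gives y = 0,
    and then the other two give z = 0 and x = 0. *)
Lemma precond_unitmx (R : realType) (m : nat) (M K : 'M[R]_m) :
  M \in unitmx -> K \in unitmx -> precond_mx M K \in unitmx.
Proof.
move=> M_unit K_unit; rewrite -mxC_unit -unitmx_tr -row_free_unit.
rewrite -kermx_eq0; apply/rowV0P=> v /sub_kermxP.
move=> /(congr1 trmx); rewrite trmx_mul trmxK trmx0.
have [x [y [z vE]]] := col3_split _ _ _ v^T.
rewrite vE mulmx_precond -[0](@vsubmxK _ m (m + m)) -[dsubmx 0](@vsubmxK _ m m).
rewrite !linear0 => /col3_inj[Ky].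
have y0 : y = 0 by rewrite -[y](@mulKmx _ _ _ (mxC K)) ?mxC_unit // Ky mulmx0.
rewrite y0 !mulmx0 add0r sub0r => Kz /eqP; rewrite oppr_eq0 => /eqP Mx.
apply: trmx_inj; rewrite vE y0.
rewrite -[x](@mulKmx _ _ _ (mxC M)) ?mxC_unit // Mx mulmx0.
rewrite -[z](@mulKmx _ _ _ (mxC K)^T) ?unitmx_tr ?mxC_unit // Kz mulmx0.
by rewrite /col3 !col_mx0 trmx0.
Qed.

Lemma precond_solveP (R : realType) (m p : nat) (beta : R) (M K : 'M[R]_m)
    (X Y : 'M[R[i]]_(m + (m + m), p)) :
  M \in unitmx -> K \in unitmx ->
  mxC (invmx (precond_mx M K) *m saddle_mx beta M K) *m X = Y <->
  mxC (saddle_mx beta M K) *m X = mxC (precond_mx M K) *m Y.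
Proof.
move=> M_unit K_unit; have P_unit := precond_unitmx _ _ _ _ M_unit K_unit.
rewrite mxC_mul mxC_inv -mulmxA; split=> [<-|->].
  by rewrite mulKVmx ?mxC_unit.
by rewrite mulKmx ?mxC_unit.
Qed.

(** The last two block rows of A and P coincide, hence the factor 1 - lam: it
    disappears for lam = 1, and forces two homogeneous equations otherwise. *)
Lemma precond_saddle_eigenP (R : realType) (m p : nat) (beta : R) (M K : 'M[R]_m)
    (lam : R[i]) (x y z : 'M[R[i]]_(m, p)) :
  M \in unitmx -> K \in unitmx ->
  mxC (invmx (precond_mx M K) *m saddle_mx beta M K) *m col3 x y z =
    lam *: col3 x y z <->
  [/\ (2 * beta%:C) *: (mxC M *m x) - mxC M *m z = lam *: (mxC K *m y),
      (1 - lam) *: (mxC M *m y + (mxC K)^T *m z) = 0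
    & (1 - lam) *: (mxC K *m y - mxC M *m x) = 0].
Proof.
move=> M_unit K_unit; rewrite precond_solveP // mulmx_saddle -scalemxAr.
rewrite mulmx_precond scale_col3 col3_inj.
split=> -[E1 E2 E3]; split=> //.
- by rewrite scalerBl scale1r {1}E2 subrr.
- by rewrite scalerBl scale1r {1}E3 subrr.
- by apply/eqP; rewrite -subr_eq0 -{1}[X in X - _]scale1r -scalerBl E2.
- by apply/eqP; rewrite -subr_eq0 -{1}[X in X - _]scale1r -scalerBl E3.
Qed.

Lemma two_betaC_neq0 (R : realType) (beta : R) :
  0 < beta -> 2 * beta%:C != 0 :> R[i].
Proof.
move=> beta_gt0; rewrite mulf_neq0 ?pnatr_eq0 //.
by rewrite eq_complex /= eqxx andbT gt_eqF.
Qed.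

(** For lam = 1 only the first block row remains, and it determines x. *)
Lemma precond_saddle_fixedP (R : realType) (m p : nat) (beta : R) (M K : 'M[R]_m)
    (x y z : 'M[R[i]]_(m, p)) :
  0 < beta -> M \in unitmx -> K \in unitmx ->
  mxC (invmx (precond_mx M K) *m saddle_mx beta M K) *m col3 x y z =
    col3 x y z <->
  x = (2 * beta%:C)^-1 *: (z + mxC (invmx M *m K) *m y).
Proof.
move=> /two_betaC_neq0 b0 M_unit K_unit.
have Mc_unit : mxC M \in unitmx by rewrite mxC_unit.
rewrite -{2}[col3 x y z]scale1r precond_saddle_eigenP // subrr !scale0r scale1r.
rewrite mxC_mul mxC_inv -mulmxA; split=> [[E _ _]|->].
  apply: (scalerI b0); rewrite scalerA mulfV // scale1r.
  by rewrite -E mulmxBr -scalemxAr !mulKmx // addrC subrK.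
split=> //; rewrite -scalemxAr scalerA mulfV // scale1r mulmxDr mulKVmx //.
by rewrite addrAC subrr add0r.
Qed.

Lemma mulmx_reduced (R : realType) (m p : nat) (beta : R) (M K : 'M[R]_m)
    (z : 'M[R[i]]_(m, p)) :
  mxC (reduced_mx beta M K) *m z =
  (2 * beta%:C) *: z +
    invmx (mxC K)^T *m (mxC M *m (invmx (mxC K) *m (mxC M *m z))).
Proof.
rewrite /reduced_mx {1}/mxC map_mxD map_scalar_mx -/(mxC _) !mxC_mul.
rewrite !mxC_inv mxC_tr mulmxDl mul_scalar_mx -!mulmxA.
by rewrite rmorphM /= rmorphD rmorph1.
Qed.

(** Multiply (B - 2 beta) z = (lam - 2 beta) z by K M^-1 K^T, which is the
    inverse of the factor K^-T M K^-1 of B - 2 beta. *)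
Lemma reduced_eigenP (R : realType) (m p : nat) (beta : R) (M K : 'M[R]_m)
    (lam : R[i]) (z : 'M[R[i]]_(m, p)) :
  M \in unitmx -> K \in unitmx ->
  mxC (reduced_mx beta M K) *m z = lam *: z <->
  mxC M *m z = (lam - 2 * beta%:C) *: (mxC (K *m invmx M *m K^T) *m z).
Proof.
rewrite -mxC_unit -(mxC_unit _ _ K) mulmx_reduced => M_unit K_unit.
rewrite !mxC_mul mxC_inv mxC_tr -!mulmxA scalerBl.
have KT_unit : (mxC K)^T \in unitmx by rewrite unitmx_tr.
split=> [E|->].
  have E' : invmx (mxC K)^T *m (mxC M *m (invmx (mxC K) *m (mxC M *m z))) =
      (lam - 2 * beta%:C) *: z.
    by rewrite scalerBl -E addrAC subrr add0r.
  rewrite -scalerBl !scalemxAr -E' mulKVmx // mulKmx // mulKVmx //.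
rewrite -scalerBl -!scalemxAr mulKmx // mulKVmx // mulKmx //.
by rewrite scalerBl addrC subrK.
Qed.

(** [other_eigvec] is built to annihilate the block rows common to A and P, so
    the first block row is the whole eigenvalue equation. This holds also when
    lam = 1. *)
Lemma mulmx_other_eigvecP (R : realType) (m : nat) (beta : R) (M K : 'M[R]_m)
    (lam : R[i]) (z : 'cV[R[i]]_m) :
  M \in unitmx -> K \in unitmx ->
  mxC (invmx (precond_mx M K) *m saddle_mx beta M K) *m other_eigvec M K z =
    lam *: other_eigvec M K z <->
  mxC (reduced_mx beta M K) *m z = lam *: z.
Proof.
move=> M_unit K_unit.
have Mc_unit : mxC M \in unitmx by rewrite mxC_unit.
rewrite reduced_eigenP // precond_saddle_eigenP // !mxC_mul mxC_inv mxC_tr !mulmxN.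
rewrite -!mulmxA !mulKVmx // addNr opprK addNr !scaler0.
set t := mxC K *m _; rewrite scalerBl !scalerN.
split=> [[E _ _]|->]; last by rewrite opprB addKr.
by apply: oppr_inj; rewrite opprB -E addNKr.
Qed.

Lemma other_eigvec_neq0 (R : realType) (m : nat) (M K : 'M[R]_m)
    (z : 'cV[R[i]]_m) :
  (other_eigvec M K z != 0) = (z != 0).
Proof.
rewrite /other_eigvec /col3 !col_mx_eq0 !oppr_eq0.
by case: (eqVneq z 0) => [->|_]; rewrite ?mulmx0 ?eqxx ?andbF.
Qed.

Lemma unit_eigvec_neq0 (R : realType) (m : nat) (beta : R) (M K : 'M[R]_m)
    (y z : 'cV[R[i]]_m) :
  unit_eigvec beta M K y z != 0 <-> y != 0 \/ z != 0.
Proof.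
rewrite /unit_eigvec /col3 !col_mx_eq0.
case: (eqVneq y 0) => [->|_]; case: (eqVneq z 0) => [->|_].
- by rewrite mulmx0 addr0 scaler0 eqxx /=; split=> // -[].
- by rewrite !andbF; split=> // _; right.
- by rewrite !andbF; split=> // _; left.
- by rewrite !andbF; split=> // _; left.
Qed.

(** * The characteristic polynomial *)

(** The columns of S are the complement (1, 0, 0) followed by the fixed vectors
    with free parameters y and z, and P^-1 A S = S T with T block triangular. *)
Lemma char_poly_precond_saddle (R : realType) (m : nat) (beta : R)
    (M K : 'M[R]_m) :
  0 < beta -> M \in unitmx -> K \in unitmx ->
  char_poly (mxC (invmx (precond_mx M K) *m saddle_mx beta M K)) =
  ('X - 1%:P) ^+ (m + m) * char_poly (mxC (reduced_mx beta M K)).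
Proof.
move=> beta_gt0 M_unit K_unit; have b0 := two_betaC_neq0 _ _ beta_gt0.
have Mc_unit : mxC M \in unitmx by rewrite mxC_unit.
have Kc_unit : mxC K \in unitmx by rewrite mxC_unit.
have KcT_unit : (mxC K)^T \in unitmx by rewrite unitmx_tr.
set PA := mxC (_ *m _); set B := mxC (reduced_mx _ _ _).
pose b : R[i] := 2 * beta%:C.
(* Side by side, the pairs (y, z) = (1, 0) and (0, 1). *)
pose Y : 'M[R[i]]_(m, m + m) := row_mx 1%:M 0.
pose Z : 'M[R[i]]_(m, m + m) := row_mx 0 1%:M.
pose X := b^-1 *: (Z + mxC (invmx M *m K) *m Y).
(* P^-1 A (1, 0, 0) has y-block D1 and z-block D2: they solve the first two
   block rows K D1 = 2 beta M and M D1 + K^T D2 = 0. *)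
pose D1 := b *: (invmx (mxC K) *m mxC M).
pose D2 := - (invmx (mxC K)^T *m (mxC M *m D1)).
pose S : 'M[R[i]]_(m + (m + m)) := block_mx 1%:M X 0 1%:M.
pose T : 'M[R[i]]_(m + (m + m)) := block_mx B 0 (col_mx D1 D2) 1%:M.
have S_unit : S \in unitmx by rewrite unitmxE det_ublock !det1 mulr1 unitr1.
have YZ : col_mx Y Z = 1%:M by rewrite -block_mxEv -scalar_mx_block.
have SE : S = row_mx (col3 1%:M 0 0) (col3 X Y Z).
  by rewrite /S /col3 YZ col_mx0 -block_mxEh.
have fixXYZ : PA *m col3 X Y Z = col3 X Y Z by apply/precond_saddle_fixedP.
have firstcol : PA *m col3 1%:M 0 0 = S *m col_mx B (col_mx D1 D2).
  have KD1 : mxC K *m D1 = b *: mxC M by rewrite -scalemxAr mulKVmx.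
  apply/precond_solveP => //; rewrite mulmx_saddle.
  (* Adding to B the x-block of the fixed part cancels K^-T M K^-1 M. *)
  have -> : S *m col_mx B (col_mx D1 D2) = col3 (b%:M + 1%:M) D1 D2.
    rewrite /S mul_block_col !mul1mx mul0mx add0r /col3; congr col_mx.
    rewrite /X -scalemxAl mulmxDl -mulmxA /Y /Z !mul_row_col.
    rewrite !mul1mx !mul0mx addr0 add0r mxC_mul mxC_inv -mulmxA.
    rewrite KD1 -scalemxAr mulVmx // scalerDr.
    rewrite scalerA mulVf // scale1r /D2 /D1 -!scalemxAr scalerN scalerA mulVf //.
    rewrite scale1r -[B]mulmx1 mulmx_reduced mulmx1 scalemx1.
    by rewrite addrA addrK.
  rewrite mulmx_precond; apply/col3_inj.
  rewrite !mulmx0 subr0 addr0 sub0r mulmx1.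
  split=> //; first by rewrite mulmxN mulKVmx // subrr.
  by rewrite KD1 mulmxDr mulmx1 mul_mx_scalar opprD addrA subrr add0r.
rewrite (@char_poly_intertwine _ _ _ S T) //.
  by rewrite char_poly_lblock char_poly1 mulrC.
rewrite {1}SE mul_mx_row fixXYZ firstcol.
rewrite /T block_mxEh mul_mx_row /S !mul_block_col.
by rewrite !mulmx0 !mul0mx !mulmx1 !add0r /col3 YZ.
Qed.

Theorem theorem1 (R : realType) (m : nat) (beta : R) (M K : 'M[R]_m)
    (m_ge1 : (1 <= m)%N) (beta_gt0 : 0 < beta)
    (M_spd : sym_posdef M) (K_unit : K \in unitmx) :
  let PA : 'M[R[i]]_(m + (m + m)) :=
    mxC (invmx (precond_mx M K) *m saddle_mx beta M K) in
  let B : 'M[R[i]]_m := mxC (reduced_mx beta M K) in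
  exists s : m.-tuple R[i],
    [/\ eigenvalues_are PA (nseq (2 * m) 1 ++ s),
        forall w : 'cV[R[i]]_(m + (m + m)),
          is_eigenvector PA 1 w <->
          exists y z : 'cV[R[i]]_m,
            (y != 0 \/ z != 0) /\ w = unit_eigvec beta M K y z,
        forall lam : R[i],
          lam \in s <-> exists z : 'cV[R[i]]_m, is_eigenvector B lam z,
        forall (lam : R[i]) (z : 'cV[R[i]]_m),
          is_eigenvector B lam z ->
          lam = 2 * beta%:C + qform M z / qform (K *m invmx M *m K^T) z /\
          is_eigenvector PA lam (other_eigvec M K z)
      & forall (lam : R[i]) (v : 'cV[R[i]]_(m + (m + m))),
          lam \in s -> lam != 1 -> is_eigenvector PA lam v ->
          exists z : 'cV[R[i]]_m,
            is_eigenvector B lam z /\ v = other_eigvec M K z].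
Proof.
move=> PA B; have M_unit := sym_posdef_unitmx _ _ _ M_spd.
have Mc_unit : mxC M \in unitmx by rewrite mxC_unit.
have [s charB] := closed_field_poly_normal (char_poly B).
move: charB; rewrite (monicP (char_poly_monic B)) scale1r => charB.
have size_s : size s == m.
  by rewrite -eqSS -(size_prod_XsubC s id) -charB size_char_poly.
exists (Tuple size_s); split=> [|w|lam|lam z|lam v _ lam1].
- rewrite /eigenvalues_are big_cat /= -charB big_nseq iter_mulr_1.
  by rewrite char_poly_precond_saddle // mul2n addnn.
- split=> [[w0]|[y [z [yz0 ->]]]]; last first.
    split; first exact/unit_eigvec_neq0.
    by rewrite scale1r; apply/precond_saddle_fixedP.
  have [x [y [z wE]]] := col3_split _ _ _ w.
  rewrite scale1r wE => PAw.
  have xE := (precond_saddle_fixedP _ _ _ _ _ _ _ _ _ beta_gt0 M_unit K_unit).1 PAw.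
  exists y, z; have wE' : col3 x y z = unit_eigvec beta M K y z by rewrite xE.
  by split=> //; apply/(unit_eigvec_neq0 _ _ beta M K); rewrite -wE' -wE.
- rewrite memtE /= -root_prod_XsubC -charB.
  by split=> /root_char_polyP.
- move=> [z0 Bz]; split; last first.
    by split; [rewrite other_eigvec_neq0 | apply/mulmx_other_eigvecP].
  have q_gt0 := qform_gt0 _ _ _ _ (sym_posdef_congr _ _ _ _ M_spd K_unit) z0.
  move/reduced_eigenP: Bz => /(_ M_unit K_unit) Mz.
  suff -> : qform M z = (lam - 2 * beta%:C) * qform (K *m invmx M *m K^T) z.
    by rewrite mulfK ?gt_eqF // addrC subrK.
  by rewrite /qform -mulmxA Mz -scalemxAr mxE mulmxA.
- have [x [y [z vE]]] := col3_split _ _ _ v.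
  rewrite vE => -[v0 PAv]; exists z.
  have lam1' : 1 - lam != 0 by rewrite subr_eq0 eq_sym.
  have [_ E2 E3] := (precond_saddle_eigenP _ _ _ _ _ _ _ _ _ _ M_unit K_unit).1 PAv.
  have yE : y = - (mxC (invmx M *m K^T) *m z).
    move/eqP: E2; rewrite scaler_eq0 (negPf lam1') addr_eq0 => /eqP E2.
    by rewrite mxC_mul mxC_inv mxC_tr -mulmxA -mulmxN -E2 mulKmx.
  have xE : x = - (mxC (invmx M *m K *m invmx M *m K^T) *m z).
    move/eqP: E3; rewrite scaler_eq0 (negPf lam1') subr_eq0 => /eqP E3.
    by rewrite -[x](mulKmx Mc_unit) -E3 yE !mxC_mul mxC_inv !mulmxN !mulmxA.
  have vE' : col3 x y z = other_eigvec M K z by rewrite xE yE.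
  split=> //; split; first by rewrite -(other_eigvec_neq0 _ _ M K) -vE'.
  by apply/mulmx_other_eigvecP; rewrite // -vE'.
Qed.
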